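(* Let $A\in\mathbb{R}^{n_x\times n_x}$, $E\in\mathbb{R}^{n_x\times n_w}$, $\Sigma_w\in\mathbb{R}^{n_w\times n_w}$ with $\Sigma_w\succ 0$, and $\varepsilon\in(0,1)$. Consider the discrete-time linear stochastic system $x_{t+1}=Ax_t+Ew_t$, $t\in\mathbb{Z}_{\ge 0}$, and assume that $\|A\|<1$ and $(A,E)$ is reachable. For $r>0$ define $\mathcal{D}=\{x\in\mathbb{R}^{n_x}:\|x\|^2-r^2\le 0\}$. If $$r^2\ge\frac{1}{\varepsilon(1-\|A\|)^2}\operatorname{Tr}(\Sigma_wE^\top E),$$ then $\mathcal{D}$ is a worst-case CVaR positively invariant set for the system, i.e., for any state $x_t\in\mathcal{D}$, $$\sup_{\mathbb{P}\in\mathcal{P}_k}\mathbb{P}\text{-CVaR}_\varepsilon[\|x_{t+k}\|^2-r^2]\le 0\quad\text{for all } k\in\mathbb{Z}_{>0}.$$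
   Context: $\|\cdot\|$ is the Euclidean norm on vectors and the maximum singular value on matrices; $M\succ 0$ means positive definite. Reachability of $(A,E)$ means $\operatorname{rank}[E, AE,\dots,A^{n_x-1}E]=n_x$. CVaR: for a probability distribution $\mathbb{P}$ of a random vector $\xi$ and a measurable loss $L$, at level $\varepsilon\in(0,1)$, $\mathbb{P}\text{-CVaR}_\varepsilon[L(\xi)]=\inf_{\beta\in\mathbb{R}}\{\beta+\frac1\varepsilon\mathbb{E}_{\mathbb{P}}[(L(\xi)-\beta)^+]\}$, where $x^+=\max\{x,0\}$. The worst-case CVaR over a set of distributions is the supremum of CVaR over that set. Setting: the disturbances $w_t\in\mathbb{R}^{n_w}$ are i.i.d. with mean zero and covariance $\Sigma_w$, but their distribution is otherwise unknown. $\mathcal{P}_k$ is the set of all probability distributions on $\mathbb{R}^{n_wk}$ with mean zero and covariance $I_k\otimes\Sigma_w$. Definition: for a continuous $f:\mathbb{R}^{n_x}\to\mathbb{R}$, the set $\mathcal{D}=\{x: f(x)\le 0\}$ is a worst-case CVaR positively invariant set if for any state $x_t\in\mathcal{D}$ one has $\sup_{\mathbb{P}\in\mathcal{P}_k}\mathbb{P}\text{-CVaR}_\varepsilon[f(x_{t+k})]\le 0$ for all $k\in\mathbb{Z}_{>0}$. Here $x_t$ is regarded as a given (deterministic) vector, and $x_{t+k}=A^kx_t+\sum_{j=0}^{k-1}A^{k-1-j}Ew_{t+j}$ is a function of $x_t$ and the stacked disturbance $[w_t^\top,\dots,w_{t+k-1}^\top]^\top$, whose law ranges over $\mathcal{P}_k$.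 In the claim $f(x)=\|x\|^2-r^2$. *)

(* Defs.v *)
From HB Require Import structures.
From mathcomp Require Import all_boot all_order all_algebra.
From mathcomp Require Import mxtens.
From mathcomp Require Import all_classical all_reals all_analysis.

Set Implicit Arguments.
Unset Strict Implicit.
Unset Printing Implicit Defensive.

Import Order.TTheory GRing.Theory Num.Theory.
Import numFieldNormedType.Exports.

Local Open Scope classical_set_scope.
Local Open Scope ring_scope.

(* The library's norm `|x| on matrices is the max norm, hence the two
   definitions that follow. *)
Definition norm2 (R : realType) (n : nat) (x : 'cV[R]_n) : R :=
  Num.sqrt (\sum_i x i 0 ^+ 2).

Definition singular_values (R : realType) (m n : nat) (M : 'M[R]_(m, n)) :
    set R :=
  [set s | exists2 l : R, eigenvalue (M^T *m M) l & s = Num.sqrt l].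

(* [singular_values M] is finite, and nonempty when 0 < n, so this supremum is
   a maximum (it is 0 when n = 0). *)
Definition max_singular_value (R : realType) (m n : nat) (M : 'M[R]_(m, n)) :
    R :=
  sup (singular_values M).

Definition posdefmx (R : realType) (n : nat) (M : 'M[R]_n) : Prop :=
  M^T = M /\ forall x : 'cV[R]_n, x != 0 -> 0 < (x^T *m M *m x) 0 0.

Definition reachable (R : realType) (nx nw : nat)
    (A : 'M[R]_nx) (E : 'M[R]_(nx, nw)) : Prop :=
  \rank (\mxrow_(j < nx) (A ^+ j *m E)) = nx.

(* The state k steps after the state x, under the disturbances
   w 0, ..., w (k - 1), for the dynamics x_{t+1} = A x_t + E w_t. *)
Definition state_after (R : realType) (nx nw : nat) (A : 'M[R]_nx)
    (E : 'M[R]_(nx, nw)) (x : 'cV[R]_nx) (k : nat) (w : 'I_k -> 'cV[R]_nw) :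
    'cV[R]_nx :=
  A ^+ k *m x + \sum_(j < k) A ^+ (k - 1 - j) *m E *m w j.

Lemma state_after0 (R : realType) (nx nw : nat) (A : 'M[R]_nx)
    (E : 'M[R]_(nx, nw)) (x : 'cV[R]_nx) (w : 'I_0 -> 'cV[R]_nw) :
  state_after A E x w = x.
Proof. by rewrite /state_after big_ord0 addr0 expr0 mul1mx. Qed.

Lemma state_afterS (R : realType) (nx nw : nat) (A : 'M[R]_nx)
    (E : 'M[R]_(nx, nw)) (x : 'cV[R]_nx) (k : nat)
    (w : 'I_k.+1 -> 'cV[R]_nw) :
  state_after A E x w =
  A *m state_after A E x (fun j : 'I_k => w (widen_ord (leqnSn k) j))
  + E *m w ord_max.
Proof.
rewrite /state_after big_ord_recr /= subn1 /= subnn expr0 mul1mx addrA.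
congr (_ + _); rewrite mulmxDr mulmxA -[A *m A ^+ k]/(A * A ^+ k) -exprS.
congr (_ + _); rewrite mulmx_sumr; apply: eq_bigr => j _.
rewrite !mulmxA -[A *m A ^+ _]/(A * A ^+ _) -exprS; congr (A ^+ _ *m _ *m _).
by rewrite -subnDA add1n subnSK.
Qed.

(* The vectors of R^n carrying probability distributions are n-tuples, which
   the library equips with the product of the Borel sigma-algebras of R. The
   j-th block of a stacked vector of R^(k nw) consists of the coordinates
   j nw, ..., j nw + nw - 1; [tensmx] uses the same indexing. *)
Definition block (R : realType) (nw k : nat) (xi : (k * nw).-tuple R)
    (j : 'I_k) : 'cV[R]_nw :=
  \col_(a < nw) tnth xi (mxtens_index (j, a)).

Definition has_mean0 (R : realType) (n : nat)
    (P : probability (n.-tuple R) R) : Prop :=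
  forall i : 'I_n, ('E_P[fun xi => tnth xi i] = 0)%E.

(* Together with [has_mean0], a finite diagonal makes every coordinate square
   integrable. *)
Definition has_covariance (R : realType) (n : nat)
    (P : probability (n.-tuple R) R) (S : 'M[R]_n) : Prop :=
  forall i j : 'I_n,
    covariance P (fun xi => tnth xi i) (fun xi => tnth xi j) = (S i j)%:E.

(* [tensmx] is the Kronecker product. *)
Definition ambiguity_set (R : realType) (nw : nat) (Sigma : 'M[R]_nw)
    (k : nat) : set (probability ((k * nw).-tuple R) R) :=
  [set P | has_mean0 P /\ has_covariance P (tensmx (1%:M : 'M[R]_k) Sigma)].

Arguments ambiguity_set {R nw} Sigma k _.

Definition CVaR (R : realType) (d : measure_display) (T : measurableType d)
    (eps : R) (P : probability T R) (L : T -> R) : \bar R :=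
  ereal_inf (range (fun b : R =>
    b%:E + (1 / eps)%:E * 'E_P[fun xi => Num.max (L xi - b)%R 0%R])%E).

Definition worst_case_CVaR (R : realType) (d : measure_display)
    (T : measurableType d) (eps : R) (Ps : set (probability T R))
    (L : T -> R) : \bar R :=
  ereal_sup [set CVaR eps P L | P in Ps].

(* The set {x | f x <= 0} is worst-case CVaR positively invariant. *)
Definition worst_case_CVaR_positively_invariant (R : realType) (nx nw : nat)
    (A : 'M[R]_nx) (E : 'M[R]_(nx, nw)) (Sigma : 'M[R]_nw) (eps : R)
    (f : 'cV[R]_nx -> R) : Prop :=
  continuous f /\
  forall x : 'cV[R]_nx, [set y | f y <= 0] x ->
  forall k : nat, (0 < k)%N ->
    (worst_case_CVaR eps (ambiguity_set Sigma k)
       (fun xi => f (state_after A E x (block xi))) <= 0)%E.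

(* Main.v *)
(** Write [a] for the largest singular value of [A]. Convexity of the square
    with weights [a] and [1 - a] gives
    [|A y + v|^2 <= a |y|^2 + |v|^2 / (1 - a)], so that, iterating,
    [|x_{t+k}|^2 <= a^k |x_t|^2 + \sum_j a^(k-1-j) / (1 - a) |E w_j|^2].
    Each [|E w_j|^2] has expectation [\tr (Sigma E^T E)] under every law of the
    ambiguity set, and the choice [b = a^k r^2 - r^2] in the infimum defining
    the CVaR bounds it by
    [b + (1 - a^k) \tr (Sigma E^T E) / (eps (1 - a)^2) <= 0]. *)

Require Import Defs.
From HB Require Import structures.
From mathcomp Require Import all_boot all_order all_algebra.
From mathcomp Require Import mxtens.
From mathcomp Require Import all_classical all_reals all_analysis.
From mathcomp Require Import measurable_realfun.
From mathcomp Require Import ring lra zify.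

Set Implicit Arguments.
Unset Strict Implicit.
Unset Printing Implicit Defensive.

Import Order.TTheory GRing.Theory Num.Theory.
Import numFieldNormedType.Exports.

Local Open Scope classical_set_scope.
Local Open Scope ring_scope.


(** * Continuity, squared Euclidean norms and semidefinite forms *)

Lemma continuous_add (R : realType) (T : topologicalType) (f g : T -> R) :
  continuous f -> continuous g -> continuous (fun x => f x + g x).
Proof. by move=> cf cg x; apply: cvgD; [exact: cf|exact: cg]. Qed.

Lemma continuous_mul (R : realType) (T : topologicalType) (f g : T -> R) :
  continuous f -> continuous g -> continuous (fun x => f x * g x).
Proof. by move=> cf cg x; apply: cvgM; [exact: cf|exact: cg]. Qed.

Lemma continuous_sum (R : realType) (T : topologicalType) (I : Type)
    (s : seq I) (f : I -> T -> R) :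
  (forall i, continuous (f i)) -> continuous (fun x => \sum_(i <- s) f i x).
Proof.
move=> cf; elim: s => [|i s IHs].
  by under eq_fun do rewrite big_nil; exact: cst_continuous.
by under eq_fun do rewrite big_cons; exact: continuous_add.
Qed.

Lemma sqr_norm2E (R : realType) n (x : 'cV[R]_n) :
  norm2 x ^+ 2 = \sum_i x i 0 ^+ 2.
Proof. by rewrite sqr_sqrtr// sumr_ge0// => i _; exact: sqr_ge0. Qed.

Lemma sqr_norm2_mx (R : realType) n (x : 'cV[R]_n) :
  norm2 x ^+ 2 = (x^T *m x) 0 0.
Proof.
by rewrite sqr_norm2E !mxE; apply: eq_bigr => i _; rewrite mxE expr2.
Qed.

Lemma sqr_norm2_trmx (R : realType) n (v : 'rV[R]_n) :
  norm2 v^T ^+ 2 = (v *m v^T) 0 0.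
Proof. by rewrite sqr_norm2_mx trmxK. Qed.

Lemma sqr_norm2_eq0 (R : realType) n (x : 'cV[R]_n) :
  (norm2 x ^+ 2 == 0) = (x == 0).
Proof.
rewrite sqr_norm2E; apply/eqP/eqP => [/eqP|->]; last first.
  by rewrite big1// => i _; rewrite mxE expr0n.
rewrite psumr_eq0 => [/allP x0|i _]; last exact: sqr_ge0.
apply/colP => i; rewrite mxE; apply/eqP.
by have := x0 i (mem_index_enum _); rewrite /= sqrf_eq0.
Qed.

Lemma row_sqr_gt0 (R : realType) n (v : 'rV[R]_n) :
  v != 0 -> 0 < (v *m v^T) 0 0.
Proof.
move=> v0; rewrite lt_def -sqr_norm2_trmx sqr_ge0 sqr_norm2_eq0 andbT.
by rewrite -trmx0 (inj_eq trmx_inj).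
Qed.

Lemma continuous_sqr_norm2 (R : realType) n :
  continuous (fun x : 'cV[R]_n => norm2 x ^+ 2).
Proof.
under eq_fun do rewrite sqr_norm2E.
apply: continuous_sum => i; under eq_fun do rewrite expr2.
by apply: continuous_mul; exact: coord_continuous.
Qed.

(* [c] minimizes the form, so the first variation at [c] in the direction
   [c *m N], which is twice the squared norm of [c *m N], vanishes. *)
Lemma psdmx_ker (R : realType) n (N : 'M[R]_n) (c : 'rV[R]_n) :
  N^T = N -> (forall v : 'rV[R]_n, 0 <= (v *m N *m v^T) 0 0) ->
  (c *m N *m c^T) 0 0 = 0 -> c *m N = 0.
Proof.
move=> Nsym Npsd c0; apply: trmx_inj; rewrite trmx0.
apply/eqP; rewrite -sqr_norm2_eq0 sqr_norm2_trmx; apply/eqP.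
set v := c *m N; set B : R := (v *m v^T) 0 0; set q : R := (v *m N *m v^T) 0 0.
have vNc : (v *m N *m c^T) 0 0 = B.
  by rewrite /B {3}/v trmx_mul Nsym mulmxA.
have q0 : 0 <= q by exact: Npsd.
have H t : 0 <= 2 * t * B + t ^+ 2 * q.
  have := Npsd (c + t *: v); congr (_ <= _).
  rewrite !mulmxDl linearD/= linearZ/= !mulmxDr -!scalemxAl -!scalemxAr.
  rewrite -/v.
  transitivity ((c *m N *m c^T) 0 0 + t * (v *m v^T) 0 0 +
    (t * (v *m N *m c^T) 0 0 + t * (t * (v *m N *m v^T) 0 0))).
    by rewrite -/v; move: (v *m c^T) (v *m v^T) (v *m N *m c^T)
         (v *m N *m v^T) => a b d e; rewrite !mxE.
  by rewrite c0 vNc -/B -/q; ring.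
(* For [q > 0] the quadratic in [H] is smallest at [- B / q]; using [q + 1] also covers [q = 0], and
   the value stays negative unless [B = 0]. *)
have := H (- B / (q + 1)).
have q1 : q + 1 != 0 by apply: lt0r_neq0; lra.
have -> : 2 * (- B / (q + 1)) * B + (- B / (q + 1)) ^+ 2 * q =
  - (B ^+ 2 * (q + 2) / (q + 1) ^+ 2) by field.
rewrite oppr_ge0 pmulr_lle0; last by rewrite invr_gt0 exprn_gt0//; lra.
rewrite pmulr_lle0; last by lra.
by move=> B0; apply/eqP; rewrite -sqrf_eq0 eq_le B0 sqr_ge0.
Qed.

(** * Norm inequalities and the largest singular value *)

(** The form attains a maximum [l] on the compact unit sphere, at some [c]. Then [l%:M - M] is
    positive semidefinite and its form vanishes at [c], so [psdmx_ker] makes [c] an eigenvector. *)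
Lemma rayleigh_max (R : realType) n (M : 'M[R]_n) : (0 < n)%N -> M^T = M ->
  exists2 l, eigenvalue M l &
    forall v : 'rV[R]_n, (v *m M *m v^T) 0 0 <= l * (v *m v^T) 0 0.
Proof.
case: n M => [//|n] M _ Msym.
pose S : set 'rV[R]_n.+1 := [set v | (v *m v^T) 0 0 = 1].
have vvE (v : 'rV[R]_n.+1) : (v *m v^T) 0 0 = \sum_i v 0 i ^+ 2.
  by rewrite mxE; apply: eq_bigr => i _; rewrite mxE expr2.
have cvv : continuous (fun v : 'rV[R]_n.+1 => (v *m v^T) 0 0).
  under eq_fun do rewrite vvE.
  apply: continuous_sum => i; under eq_fun do rewrite expr2.
  by apply: continuous_mul; exact: coord_continuous.
have cS : compact S.
  (* Unit vectors have coordinates in [[-1, 1]], so the sphere is a closed subset of a compact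
     box. *)
  have cbox := @rV_compact R n.+1 (fun=> `[-1, 1]%classic)
    (fun=> @segment_compact R (-1) 1).
  apply: (subclosed_compact _ cbox).
    exact: (continuous_closedP _).1 cvv [set 1] (@closed_eq R 1).
  move=> v /= v1 i; rewrite in_itv /= -ler_norml.
  rewrite -(@ler_pXn2r _ 2)// ?nnegrE//.
  rewrite real_normK ?num_real// expr1n -[leRHS]v1 vvE (bigD1 i)//= lerDl.
  by rewrite sumr_ge0// => j _; exact: sqr_ge0.
have S0 : S !=set0.
  exists (delta_mx 0 0); rewrite /S /= vvE (bigD1 0)//= big1 => [|j j0].
    by rewrite mxE /= expr1n addr0.
  by rewrite mxE (negbTE j0) expr0n.
have cf : continuous (fun v : 'rV[R]_n.+1 => (v *m M *m v^T) 0 0).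
  have fE (v : 'rV[R]_n.+1) :
      (v *m M *m v^T) 0 0 = \sum_i \sum_j v 0 j * M j i * v 0 i.
    by rewrite mxE; apply: eq_bigr => i _; rewrite !mxE big_distrl.
  under eq_fun do rewrite fE.
  apply: continuous_sum => i; apply: continuous_sum => j.
  apply: continuous_mul; last exact: coord_continuous.
  apply: continuous_mul; first exact: coord_continuous.
  exact: cst_continuous.
have [c cinS cmax] := EVT_max_rV S0 cS (continuous_subspaceT cf).
set l := (c *m M *m c^T) 0 0 in cmax *.
have c1 : (c *m c^T) 0 0 = 1 by move: cinS; rewrite inE.
have le_l (v : 'rV[R]_n.+1) : (v *m M *m v^T) 0 0 <= l * (v *m v^T) 0 0.
  have [->|v0] := eqVneq v 0; first by rewrite !mul0mx !mxE mulr0.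
  have vv_gt0 := row_sqr_gt0 v0.
  set s := Num.sqrt ((v *m v^T) 0 0).
  have s_gt0 : 0 < s by rewrite sqrtr_gt0.
  have s2 : (v *m v^T) 0 0 = s ^+ 2 by rewrite sqr_sqrtr// ltW.
  have sinS : s^-1 *: v \in S.
    rewrite inE /S /= linearZ/= -scalemxAl -scalemxAr scalerA mxE s2.
    by field; rewrite gt_eqF.
  have /= := cmax _ sinS.
  rewrite linearZ/= -!scalemxAl -scalemxAr scalerA mxE s2 -invfM -expr2.
  by rewrite ler_pdivrMl ?exprn_gt0// mulrC.
exists l => //; apply/eigenvalueP; exists c; last first.
  by apply: contra_eq_neq c1 => ->; rewrite mul0mx mxE eq_sym oner_neq0.
have formE (v : 'rV[R]_n.+1) : (v *m (l%:M - M) *m v^T) 0 0 =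
    l * (v *m v^T) 0 0 - (v *m M *m v^T) 0 0.
  rewrite mulmxBr mulmxBl mul_mx_scalar -scalemxAl.
  by move: (v *m v^T) (v *m M *m v^T) => a b; rewrite !mxE.
suff : c *m (l%:M - M) = 0.
  by rewrite mulmxBr mul_mx_scalar => /eqP; rewrite subr_eq0 eq_sym => /eqP.
apply: psdmx_ker => [|v|].
- by rewrite linearB/= tr_scalar_mx Msym.
- by rewrite formE subr_ge0.
- by rewrite formE c1 mulr1 subrr.
Qed.

Lemma max_singular_value_ge0 (R : realType) m n (A : 'M[R]_(m, n)) :
  0 <= max_singular_value A.
Proof.
(* [sup] takes the default value 0 on an empty or unbounded set; otherwise it dominates a square
   root. *)
have [[s As]|/set0P/negP] := pselect (singular_values A !=set0); last first.
  by rewrite negbK => /eqP; rewrite /max_singular_value => ->; rewrite sup0.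
have [hs|nhs] := pselect (has_sup (singular_values A)).
  apply: le_trans (ub_le_sup hs.2 As).
  by case: As => l _ ->; exact: sqrtr_ge0.
by rewrite /max_singular_value sup_out.
Qed.

(** The Rayleigh bound for the Gram matrix [A^T *m A] has constant [l], an eigenvalue, so
    [Num.sqrt l] is a singular value and lies below the supremum. *)
Lemma sqr_norm2_mulmx_le (R : realType) m n (A : 'M[R]_(m, n))
    (x : 'cV[R]_n) :
  norm2 (A *m x) ^+ 2 <= max_singular_value A ^+ 2 * norm2 x ^+ 2.
Proof.
have [n0|n_gt0] := posnP n.
  subst n; rewrite [x]flatmx0 mulmx0.
  have /eqP -> : norm2 (0 : 'cV[R]_m) ^+ 2 == 0 by rewrite sqr_norm2_eq0.
  by rewrite mulr_ge0// sqr_ge0.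
have Gsym : (A^T *m A)^T = A^T *m A by rewrite trmx_mul trmxK.
have [l eigl le_l] := rayleigh_max n_gt0 Gsym.
have GE (v : 'rV[R]_n) :
    (v *m (A^T *m A) *m v^T) 0 0 = norm2 (A *m v^T) ^+ 2.
  by rewrite sqr_norm2_mx trmx_mul trmxK !mulmxA.
have eig_le t : eigenvalue (A^T *m A) t -> 0 <= t <= l.
  case/eigenvalueP => v vG v0.
  have vv_gt0 := row_sqr_gt0 v0.
  have := le_l v; have := GE v; rewrite vG -scalemxAl mxE => tE.
  rewrite ler_pM2r// => ->; rewrite andbT -(pmulr_lge0 _ vv_gt0) tE.
  exact: sqr_ge0.
have l0 : 0 <= l by have /andP[] := eig_le _ eigl.
have smax : singular_values A (Num.sqrt l) by exists l.
(* Without an upper bound [sup] would be its default 0; [l] dominates every eigenvalue, which bounds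
   the singular values. *)
have ubA : has_ubound (singular_values A).
  by exists (Num.sqrt l) => _ [t /eig_le /andP[_ tl] ->]; rewrite ler_sqrt.
have := le_l x^T; rewrite GE trmxK => /le_trans; apply.
rewrite -sqr_norm2_mx ler_wpM2r ?sqr_ge0// -[leLHS]sqr_sqrtr//.
rewrite ler_pXn2r// ?nnegrE ?sqrtr_ge0 ?max_singular_value_ge0//.
exact: ub_le_sup.
Qed.

(* Convexity of the square, with weights [a] and [1 - a]. *)
Lemma sqr_norm2D_le (R : realType) n (a p : R) (u v : 'cV[R]_n) :
  0 <= a -> a < 1 -> norm2 u ^+ 2 <= a ^+ 2 * p ->
  norm2 (u + v) ^+ 2 <= a * p + norm2 v ^+ 2 / (1 - a).
Proof.
move=> a_ge0 a_lt1 up; have a1_gt0 : 0 < 1 - a by rewrite subr_gt0.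
(* The weight [a] is a divisor below; when it is 0, the hypothesis forces [u = 0]. *)
have [a0|a_neq0] := eqVneq a 0.
  move: up; rewrite a0 (expr2 0) !mul0r subr0 divr1 add0r => up.
  have /eqP -> : u == 0 by rewrite -sqr_norm2_eq0 eq_le up sqr_ge0.
  by rewrite add0r.
have a_gt0 : 0 < a by rewrite lt_def a_neq0.
apply: (@le_trans _ _ (norm2 u ^+ 2 / a + norm2 v ^+ 2 / (1 - a))); last first.
  by rewrite lerD2r ler_pdivrMr// mulrAC -expr2.
rewrite !sqr_norm2E !mulr_suml -big_split ler_sum// => i _; rewrite mxE /=.
move: (u i 0) (v i 0) => s t; rewrite -subr_ge0.
have -> : s ^+ 2 / a + t ^+ 2 / (1 - a) - (s + t) ^+ 2 =
    ((1 - a) * s - a * t) ^+ 2 / (a * (1 - a)).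
  by field; rewrite a_neq0 gt_eqF.
by rewrite mulr_ge0 ?sqr_ge0// invr_ge0 mulr_ge0// ltW.
Qed.

(** * Pathwise bound on the state *)

(** Induction on the last time step: the convexity bound multiplies the previous estimate by [a],
    raising each exponent by one, and the newest disturbance enters with exponent 0. *)
Lemma sqr_norm2_state_after_le (R : realType) nx nw (A : 'M[R]_nx)
    (E : 'M[R]_(nx, nw)) (x : 'cV[R]_nx) k (w : 'I_k -> 'cV[R]_nw)
    (a := max_singular_value A) : a < 1 ->
  norm2 (state_after A E x w) ^+ 2 <= a ^+ k * norm2 x ^+ 2 +
    \sum_(j < k) a ^+ (k - 1 - j) / (1 - a) * norm2 (E *m w j) ^+ 2.
Proof.
move=> a_lt1; have a_ge0 : 0 <= a by exact: max_singular_value_ge0.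
elim: k w => [|k IHk] w.
  by rewrite state_after0 expr0 mul1r big_ord0 addr0.
rewrite state_afterS; set y := state_after _ _ _ _.
have /le_trans -> // := sqr_norm2D_le (E *m w ord_max) a_ge0 a_lt1
  (sqr_norm2_mulmx_le A y).
rewrite big_ord_recr /= subn1 subnn expr0 addrA mul1r [_^-1 * _]mulrC.
rewrite lerD2r (le_trans (ler_wpM2l a_ge0 (IHk _)))//.
rewrite mulrDr mulrA -exprS lerD2l mulr_sumr ler_sum// => j _.
by rewrite !mulrA -exprS -subnDA add1n subnSK.
Qed.

Lemma sum_geometric_rev (R : realType) (a : R) k : a != 1 ->
  \sum_(j < k) a ^+ (k - 1 - j) = (1 - a ^+ k) / (1 - a).
Proof.
move=> a1; rewrite (reindex_inj rev_ord_inj) /=.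
under eq_bigr => j _.
  have -> : (k - 1 - (k - j.+1) = j)%N by have := ltn_ord j; lia.
  over.
have d0 : 1 - a != 0 by rewrite subr_eq0 eq_sym.
by apply: (mulIf d0); rewrite divfK// -[RHS]opprB subrX1; ring.
Qed.

(** * Second moments under the ambiguity set *)

(** A finite integral forces the positive and negative parts both to have finite integrals. This
    extracts integrability of products of coordinates from the prescribed covariance. *)
Lemma integrable_expectation_fin d (T : measurableType d) (R : realType)
    (P : probability T R) (X : T -> R) (s : R) :
  measurable_fun setT X -> ('E_P[X] = s%:E)%E ->
  P.-integrable setT (EFin \o X).
Proof.
move=> mX; rewrite unlock => EX; apply/integrableP; split.
  exact/measurable_EFinP.
by rewrite integral_fin_num_abs// EX.
Qed.

Lemma EFin_lincomb (T : Type) (R : realType) (I : finType) (c : I -> R)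
    (X : I -> T -> R) :
  EFin \o (fun t => \sum_i c i * X i t) =
  (fun t => \sum_i (c i)%:E * (EFin \o X i) t)%E.
Proof.
apply/funext => t /=; rewrite -sumEFin; apply: eq_bigr => i _.
by rewrite EFinM.
Qed.

Lemma integrable_lincomb d (T : measurableType d) (R : realType)
    (P : probability T R) (I : finType) (c : I -> R) (X : I -> T -> R) :
  (forall i, P.-integrable setT (EFin \o X i)) ->
  P.-integrable setT (EFin \o (fun t => \sum_i c i * X i t)).
Proof.
move=> iX; rewrite EFin_lincomb; apply: integrable_sum => // i _.
exact: integrableZl.
Qed.

Lemma expectation_lincomb d (T : measurableType d) (R : realType)
    (P : probability T R) (I : finType) (c : I -> R) (X : I -> T -> R) :
  (forall i, P.-integrable setT (EFin \o X i)) ->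
  ('E_P[fun t => (\sum_i c i * X i t)%R] = \sum_i (c i)%:E * 'E_P[X i])%E.
Proof.
move=> iX; rewrite unlock.
transitivity (\int[P]_t (\sum_i (c i)%:E * (EFin \o X i) t)%E)%E.
  by rewrite -EFin_lincomb.
rewrite integral_sum// => [|i]; last exact: integrableZl.
by apply: eq_bigr => i _; rewrite integralZl.
Qed.

Lemma expectation_coordM (R : realType) n (P : probability (n.-tuple R) R)
    (S : 'M[R]_n) i j : has_mean0 P -> has_covariance P S ->
  ('E_P[fun xi => (tnth xi i * tnth xi j)%R] = (S i j)%:E)%E.
Proof.
move=> P0 <-; rewrite covariance.unlock !P0 /=; congr expectation.
by apply/funext => xi /=; rewrite -[RHS]/((_ - _) * (_ - _)) !subr0.
Qed.

Lemma integrable_coordM (R : realType) n (P : probability (n.-tuple R) R)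
    (S : 'M[R]_n) i j : has_mean0 P -> has_covariance P S ->
  P.-integrable setT (EFin \o (fun xi => tnth xi i * tnth xi j)).
Proof.
move=> P0 PS; apply: integrable_expectation_fin (expectation_coordM i j P0 PS).
by apply: measurable_funM; exact: measurable_tnth.
Qed.

(** Expanding the quadratic form reduces its expectation to second moments of coordinates. The index
    order [p.2 p.1] matches the diagonal entries of [Sigma *m (E^T *m E)]. *)
Lemma sqr_norm2_blockE (R : realType) nx nw k (E : 'M[R]_(nx, nw))
    (j : 'I_k) :
  (fun xi => norm2 (E *m block xi j) ^+ 2) =
  (fun xi => \sum_(p : 'I_nw * 'I_nw) (E^T *m E) p.2 p.1 *
    (tnth xi (mxtens_index (j, p.1)) * tnth xi (mxtens_index (j, p.2)))).
Proof.
apply/funext => xi; rewrite sqr_norm2_mx trmx_mul -mulmxA (mulmxA E^T) mulmxA.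
move: (E^T *m E) => G; rewrite mxE.
rewrite -(pair_bigA _ (fun b a => G a b * (tnth xi (mxtens_index (j, b)) *
    tnth xi (mxtens_index (j, a))))) /=.
apply: eq_bigr => b _; rewrite !mxE mulr_suml; apply: eq_bigr => a _.
by rewrite !mxE; ring.
Qed.

Lemma integrable_sqr_norm2_block (R : realType) nx nw k (E : 'M[R]_(nx, nw))
    Sigma P (j : 'I_k) : ambiguity_set Sigma k P ->
  P.-integrable setT (EFin \o (fun xi => norm2 (E *m block xi j) ^+ 2)).
Proof.
case=> P0 PS; rewrite sqr_norm2_blockE; apply: integrable_lincomb => p.
exact: integrable_coordM P0 PS.
Qed.

Lemma expectation_sqr_norm2_block (R : realType) nx nw k
    (E : 'M[R]_(nx, nw)) Sigma P (j : 'I_k) : ambiguity_set Sigma k P ->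
  ('E_P[fun xi => (norm2 (E *m block xi j) ^+ 2)%R] =
   (\tr (Sigma *m E^T *m E))%:E)%E.
Proof.
case=> P0 PS; rewrite sqr_norm2_blockE expectation_lincomb => [|p]; last first.
  exact: integrable_coordM P0 PS.
(* Both coordinates lie in block [j], so only a diagonal block of the Kronecker product, equal to
   [Sigma], is read. *)
under eq_bigr do rewrite (expectation_coordM _ _ P0 PS) tensmxE [1%:M _ _]mxE eqxx mul1r.
under eq_bigr do rewrite -EFinM.
rewrite sumEFin -mulmxA; congr EFin; move: (E^T *m E) => G.
rewrite /mxtrace -(pair_bigA _ (fun b a => G a b * Sigma b a)) /=.
by apply: eq_bigr => b _; rewrite mxE; apply: eq_bigr => a _; rewrite mulrC.
Qed.

Lemma measurable_sqr_norm2_state_after (R : realType) nx nw (A : 'M[R]_nx)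
    (E : 'M[R]_(nx, nw)) (x : 'cV[R]_nx) k :
  measurable_fun setT (fun xi : (k * nw).-tuple R =>
    norm2 (state_after A E x (block xi)) ^+ 2).
Proof.
under eq_fun do rewrite sqr_norm2E.
apply: measurable_sum => i; apply: measurable_funX.
under eq_fun do rewrite mxE summxE.
apply: measurable_funD; first exact: measurable_cst.
apply: measurable_sum => j; under eq_fun do rewrite mxE.
apply: measurable_sum => a; apply: measurable_funM.
  exact: measurable_cst.
under eq_fun do rewrite mxE.
exact: measurable_tnth.
Qed.

(** * Invariance of the ball *)

Theorem mainTheorem2 (R : realType) (nx nw : nat)
    (A : 'M[R]_nx) (E : 'M[R]_(nx, nw)) (Sigma : 'M[R]_nw) (eps r : R)
    (Sigma_posdef : posdefmx Sigma)
    (eps_gt0 : 0 < eps) (eps_lt1 : eps < 1)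
    (A_lt1 : max_singular_value A < 1)
    (AE_reachable : reachable A E)
    (r_gt0 : 0 < r)
    (r_ge : 1 / (eps * (1 - max_singular_value A) ^+ 2)
              * \tr (Sigma *m E^T *m E) <= r ^+ 2) :
  worst_case_CVaR_positively_invariant A E Sigma eps
    (fun x : 'cV[R]_nx => norm2 x ^+ 2 - r ^+ 2).
Proof.
set a := max_singular_value A in A_lt1 r_ge *.
set T := \tr _ in r_ge.
have a_ge0 : 0 <= a by exact: max_singular_value_ge0.
have a1_gt0 : 0 < 1 - a by rewrite subr_gt0.
split.
  apply: continuous_add; first exact: continuous_sqr_norm2.
  exact: cst_continuous.
move=> x /=; rewrite subr_le0 => x_le k _.
have ak_ge0 : 0 <= a ^+ k by rewrite exprn_ge0.
have ak_le1 : a ^+ k <= 1 by rewrite exprn_ile1// ltW.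
apply: ge_ereal_sup => _ [P PSigma <-].
pose b := a ^+ k * r ^+ 2 - r ^+ 2.
pose c (j : 'I_k) := a ^+ (k - 1 - j) / (1 - a).
pose N (j : 'I_k) (xi : (k * nw).-tuple R) := norm2 (E *m block xi j) ^+ 2.
(* [Q] is the disturbance part of the pathwise bound. *)
pose Q xi := \sum_j c j * N j xi.
have iN j : P.-integrable setT (EFin \o N j).
  exact: integrable_sqr_norm2_block PSigma.
have Q_ge0 xi : 0 <= Q xi.
  rewrite sumr_ge0// => j _; rewrite mulr_ge0 ?sqr_ge0//.
  by rewrite divr_ge0 ?exprn_ge0// ltW.
have mQ : measurable_fun setT Q.
  apply/measurable_EFinP; apply: (@measurable_int _ _ _ P).
  exact: integrable_lincomb.
have EQ : ('E_P[Q] = ((1 - a ^+ k) / (1 - a) ^+ 2 * T)%:E)%E.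
  rewrite expectation_lincomb//.
  under eq_bigr do rewrite (expectation_sqr_norm2_block E _ PSigma) -EFinM.
  rewrite sumEFin -mulr_suml -mulr_suml sum_geometric_rev ?lt_eqF//.
  by rewrite expr2 invfM !mulrA.
apply: ge_ereal_inf; exists (b%:E + (1 / eps)%:E *
    'E_P[fun xi => Num.max (norm2 (state_after A E x (block xi)) ^+ 2 -
      r ^+ 2 - b)%R 0%R])%E; first by exists b.
apply: (@le_trans _ _ (b%:E + (1 / eps)%:E * 'E_P[Q])%E).
  rewrite leeD2l// lee_wpmul2l // ?lee_fin ?divr_ge0 ?(ltW eps_gt0)//.
  apply: expectation_le => //.
  - apply: measurable_maxr; last exact: measurable_cst.
    apply: measurable_funB; last exact: measurable_cst.
    apply: measurable_funB; last exact: measurable_cst.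
    exact: measurable_sqr_norm2_state_after.
  - by move=> xi; rewrite le_max lexx orbT.
  (* The loss minus [b] is the squared norm of the state minus [a ^+ k * r ^+ 2], hence at most
     [Q xi] because [x] lies in the ball; [Q xi] being nonnegative absorbs the positive part. *)
  - apply: aeW => xi; rewrite ge_max Q_ge0 andbT.
    have := sqr_norm2_state_after_le E x (block xi) A_lt1.
    rewrite -/a -/(Q xi).
    have := ler_wpM2l ak_ge0 x_le.
    by rewrite /b; lra.
rewrite EQ -EFinM -EFinD lee_fin.
have -> : 1 / eps * ((1 - a ^+ k) / (1 - a) ^+ 2 * T) =
    (1 - a ^+ k) * (1 / (eps * (1 - a) ^+ 2) * T).
  by field; rewrite !gt_eqF.
(* The hypothesis on [r], scaled by [1 - a ^+ k], is exactly what [b = - (1 - a ^+ k) * r ^+ 2]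
   compensates. *)
have : (1 - a ^+ k) * (1 / (eps * (1 - a) ^+ 2) * T) <= (1 - a ^+ k) * r ^+ 2.
  by rewrite ler_wpM2l// subr_ge0.
by rewrite /b; lra.
Qed.
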